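(* Let $X$ be a continuum and $x\in X$ such that $B(x)$ is closed in $X$. Then $B(x)=\pi(x)$.
   Context: A continuum is a nonempty compact connected metric space. $2^X$ is the space of all nonempty closed subsets of $X$ with the Hausdorff metric, and $\mathcal C(X)\subset 2^X$ is the subspace of connected ones. An order arc is a continuous map $\alpha:[0,1]\to 2^X$ such that $\alpha(s)\subsetneq\alpha(t)$ whenever $0\le s<t\le 1$. For $A, B \in 2^X$, $B$ does not block $A$ if there is a continuous map $\gamma:[0,1]\to 2^X$ with $\gamma(0)=A$, $\gamma(1)=X$ and $\gamma(t)\cap B=\emptyset$ for all $t<1$; otherwise $B$ blocks $A$. For $a \in X$, $B(a)=\{y\in X : \{a\}\text{ blocks }\{y\}\}$. A nonblocker of $X$ is a set $A\in 2^X\setminus\{X\}$ such that for every $x\in X\setminus A$ there is an order arc $\alpha:[0,1]\to \mathcal C(X)$ with $\alpha(0)=\{x\}$, $\alpha(1)=X$ and $\alpha(t)\cap A=\emptyset$ for all $t\in[0,1)$. For $a\in X$, $\pi(a)$ is the intersection of all nonblockers of $X$ containing $a$ if at least one exists, and $\pi(a)=X$ otherwise. *)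

(* Defs.v *)
From HB Require Import structures.
From mathcomp Require Import all_boot all_order all_algebra.
From mathcomp Require Import all_classical all_reals.
From mathcomp Require Import topology normedtype.

Set Implicit Arguments.
Unset Strict Implicit.
Unset Printing Implicit Defensive.

Import Order.TTheory GRing.Theory Num.Theory.
Import numFieldNormedType.Exports.

Local Open Scope classical_set_scope.
Local Open Scope ring_scope.

HB.mixin Record isContinuum (R : realType) X & Metric R X := {
  continuum_neq0 : [set: X] !=set0 ;
  continuum_compact : compact [set: X] ;
  continuum_connected : connected [set: X]
}.

#[short(type="continuumType")]
HB.structure Definition Continuum (R : realType) :=
  { X of Metric R X & isContinuum R X }.

(* 2^X; its metric is the Hausdorff metric (instance below). *)
Record hyperspace (R : realType) (X : continuumType R) := Hyperspace {
  hyperset :> set X ;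
  hyperset_closed : closed hyperset ;
  hyperset_neq0 : hyperset !=set0
}.

HB.instance Definition _ (R : realType) (X : continuumType R) :=
  gen_eqMixin (hyperspace X).
HB.instance Definition _ (R : realType) (X : continuumType R) :=
  gen_choiceMixin (hyperspace X).

Section hausdorff_metric.
Context {R : realType} {X : continuumType R}.
Implicit Types (A B C : hyperspace X) (e : R).

(* The Hausdorff metric as the infimum of the radii e such that each set lies
   in the open e-neighbourhood of the other. *)
Definition neighborhood e (A : set X) : set X := \bigcup_(a in A) ball a e.

Definition hausdorff_radii A B : set R :=
  [set e | [/\ 0 < e, hyperset A `<=` neighborhood e B
                    & hyperset B `<=` neighborhood e A]].

Definition hausdorff_dist A B : R := inf (hausdorff_radii A B).

Lemma hyperset_inj A B : hyperset A = hyperset B -> A = B.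
Proof.
case: A B => [A cA nA] [B cB nB] /= AB; rewrite -{}AB in cB nB *.
by congr Hyperspace; exact: Prop_irrelevance.
Qed.

Lemma continuum_bounded (p : X) : exists2 e, 0 < e & forall y : X, ball p e y.
Proof.
apply: contrapT => unbounded.
pose F := filter_from [set e : R | 0 < e] (fun e => ~` ball p e).
have FF : ProperFilter F.
  apply: filter_from_proper; last first.
    move=> e /= e0; apply: contrapT => ball_full; apply: unbounded.
    by exists e => // y; apply: contrapT => pey; apply: ball_full; exists y.
  apply: filter_from_filter; first by exists 1 => /=.
  move=> e f /= e0 f0; exists (Num.max e f); first by rewrite /= lt_max e0.
  move=> y /= pefy; split=> pey; apply: pefy; apply: le_ball pey.
    by rewrite le_max lexx.
  by rewrite le_max lexx orbT.
have [|q [_ clq]] := @continuum_compact R X F FF.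
  by exists 1 => /=.
pose e := mdist p q + 1.
have e0 : 0 < e by rewrite ltr_wpDl// mdist_ge0.
have pq : ball p e q by rewrite ballEmdist/= ltrDl.
have Fe : F (~` ball p (e + 1)) by exists (e + 1) => //=; rewrite addr_gt0.
have [y [pey qy]] := clq _ _ Fe (nbhsx_ballx q 1 ltr01).
by apply: pey; exact: ball_triangle pq qy.
Qed.

Lemma hausdorff_radii_neq0 A B : hausdorff_radii A B !=set0.
Proof.
case: (hyperset_neq0 A) => a Aa; case: (hyperset_neq0 B) => b Bb.
have [e e0 ae] := continuum_bounded a; have [f f0 bf] := continuum_bounded b.
exists (Num.max e f); split; first by rewrite lt_max e0.
- by move=> y _; exists b => //; apply: le_ball (bf y); rewrite le_max lexx orbT.
- by move=> y _; exists a => //; apply: le_ball (ae y); rewrite le_max lexx.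
Qed.

Lemma hausdorff_radii_lbound A B : lbound (hausdorff_radii A B) 0.
Proof. by move=> e [/ltW]. Qed.

Lemma hausdorff_radii_has_inf A B : has_inf (hausdorff_radii A B).
Proof.
split; first exact: hausdorff_radii_neq0.
by exists 0; exact: hausdorff_radii_lbound.
Qed.

Lemma hausdorff_distxx A : hausdorff_dist A A = 0.
Proof.
apply/eqP; rewrite eq_le; apply/andP; split.
- apply/ler_addgt0Pr => e e0; rewrite add0r; apply: ge_inf.
    by case: (hausdorff_radii_has_inf A A).
  by split=> // y Ay; exists y => //; exact: ballxx.
- by apply: lb_le_inf;
    [exact: hausdorff_radii_neq0 | exact: hausdorff_radii_lbound].
Qed.

Lemma hausdorff_dist_sym A B : hausdorff_dist A B = hausdorff_dist B A.
Proof.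
by congr inf; apply/seteqP; split=> e [? ? ?].
Qed.

Lemma hausdorff_dist_triangle B A C :
  hausdorff_dist A C <= hausdorff_dist A B + hausdorff_dist B C.
Proof.
apply/ler_addgt0Pr => e e0.
have e20 : 0 < e / 2 by rewrite divr_gt0.
have [r [r0 AB BA] rlt] := inf_adherent e20 (hausdorff_radii_has_inf A B).
have [s [s0 BC CB] slt] := inf_adherent e20 (hausdorff_radii_has_inf B C).
apply: (@le_trans _ _ (r + s)); last first.
  by rewrite [e]splitr addrACA lerD// ltW.
apply: ge_inf; first by case: (hausdorff_radii_has_inf A C).
split; first exact: addr_gt0.
- move=> y /AB[b /BC[c Cc bc] yb]; exists c => //; rewrite addrC.
  exact: ball_triangle bc yb.
- move=> y /CB[b /BA[a Aa ab] yb]; exists a => //.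
  exact: ball_triangle ab yb.
Qed.

Lemma hausdorff_dist0_subset A B : hausdorff_dist A B = 0 ->
  hyperset A `<=` hyperset B.
Proof.
move=> AB0 y Ay; apply: hyperset_closed => U /nbhs_ballP[e /= e0 yeU].
have [r [r0 AB _]] := inf_adherent e0 (hausdorff_radii_has_inf A B).
rewrite -/(hausdorff_dist A B) AB0 add0r => re.
have [b Bb /ball_sym yb] := AB _ Ay; exists b; split => //; apply: yeU.
by apply: le_ball yb; exact: ltW.
Qed.

Lemma hausdorff_dist_positivity A B : hausdorff_dist A B = 0 -> A = B.
Proof.
move=> AB0; apply: hyperset_inj; apply/seteqP.
by split; apply: hausdorff_dist0_subset => //; rewrite hausdorff_dist_sym.
Qed.

End hausdorff_metric.

HB.instance Definition _ (R : realType) (X : continuumType R) :=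
  @isMetric.Build R (hyperspace X) hausdorff_dist hausdorff_distxx
    hausdorff_dist_positivity hausdorff_dist_sym hausdorff_dist_triangle.

Section blockers.
Context {R : realType} {X : continuumType R}.
Implicit Types (A B : hyperspace X) (a x y : X).

Lemma closed_singleton a : closed [set a].
Proof.
apply: accessible_closed_set1; apply: hausdorff_accessible.
exact: metric_hausdorff.
Qed.

Definition hypersingleton a : hyperspace X :=
  Hyperspace (@closed_singleton a) (ex_intro _ a erefl).

Definition hyperfull : hyperspace X := Hyperspace closedT continuum_neq0.

(* C(X) as a subset of 2^X. *)
Definition subcontinua : set (hyperspace X) := [set A | connected (hyperset A)].

(* A map on [0,1] is represented by a total function on R, of which only the
   restriction to [0,1] is constrained. *)
Definition order_arc (alpha : R -> hyperspace X) :=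
  {within `[0, 1], continuous alpha} /\
  forall s t : R, 0 <= s -> s < t -> t <= 1 ->
    hyperset (alpha s) `<` hyperset (alpha t).

(* B does not block A. *)
Definition not_blocks B A := exists gamma : R -> hyperspace X,
  [/\ {within `[0, 1], continuous gamma}, gamma 0 = A, gamma 1 = hyperfull &
      forall t : R, 0 <= t < 1 -> hyperset (gamma t) `&` B = set0].

Definition blocks B A := ~ not_blocks B A.

(* B(a) *)
Definition blocked_points a : set X :=
  [set y | blocks (hypersingleton a) (hypersingleton y)].

Definition nonblocker A := A <> hyperfull /\
  forall x, (~` A) x -> exists alpha : R -> hyperspace X,
    [/\ order_arc alpha, alpha @` `[0, 1] `<=` subcontinua,
        alpha 0 = hypersingleton x, alpha 1 = hyperfull &
        forall t : R, 0 <= t < 1 -> hyperset (alpha t) `&` A = set0].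

Definition nonblockers_at a : set (hyperspace X) :=
  [set A | nonblocker A /\ hyperset A a].

(* pi(a) *)
Definition nonblocker_hull a : set X :=
  if pselect (nonblockers_at a !=set0)
  then \bigcap_(A in nonblockers_at a) hyperset A
  else [set: X].

End blockers.

(* Main.v *)
Require Import Defs.
From mathcomp Require Import all_boot all_order all_algebra.
From mathcomp Require Import all_classical all_reals.
From mathcomp Require Import topology normedtype.
From mathcomp Require Import interval_inference lra.

(* Every nonblocker containing x contains B(x), so it suffices to show that
   B(x), when closed and proper, is itself a nonblocker. Given a path f in 2^X
   from {y} to X avoiding x, the sets C t, the union of f s over s <= t, form a
   nondecreasing path of continua from {y} to X. If t < 1 and z is in C t, then
   an order arc from {z} to C t followed by C shows that z is not in B(x); hence
   C t misses B(x), and C reparameterized by a Whitney map is the required order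
   arc.
   Order arcs from {z} to a continuum K are built without boundary bumping: for
   e > 0 the iterated e-neighbourhoods of z in K form a finite chain reaching K
   along which a Whitney map mu increases in small steps. An ultralimit as
   e -> 0, in the compact space 2^X, yields a chain on which mu takes all
   intermediate values, and any such chain is an order arc parameterized by
   mu. *)

Set Implicit Arguments.
Unset Strict Implicit.
Unset Printing Implicit Defensive.

Import Order.TTheory GRing.Theory Num.Theory.
Import numFieldNormedType.Exports.

Local Open Scope classical_set_scope.
Local Open Scope ring_scope.

(** * Neighbourhoods in the Hausdorff metric and compactness of $2^X$ *)

Section hyperspace_theory.
Context {R : realType} {X : continuumType R}.
Implicit Types (A B C K : hyperspace X) (p q x y z : X) (e : R).

Lemma neighborhoodS e f (A B : set X) : e <= f -> A `<=` B ->
  neighborhood e A `<=` neighborhood f B.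
Proof.
by move=> ef AB p [a Aa ap]; exists a; [exact: AB|exact: le_ball ap].
Qed.

Lemma subset_neighborhood e (A : set X) : 0 < e -> A `<=` neighborhood e A.
Proof. by move=> e0 p Ap; exists p => //; exact: ballxx. Qed.

Lemma neighborhood_trans e f (A B C : set X) :
  A `<=` neighborhood e B -> B `<=` neighborhood f C ->
  A `<=` neighborhood (e + f) C.
Proof.
move=> AB BC p /AB[b /BC[c Cc cb] bp]; exists c => //.
by rewrite addrC; exact: ball_triangle cb bp.
Qed.

Lemma open_neighborhood e (A : set X) : open (neighborhood e A).
Proof.
apply: bigcup_open => a _; rewrite openE => p; rewrite ballEmdist/= => ap.
apply/nbhs_ballP; exists (e - mdist a p); first by rewrite /= subr_gt0.
move=> q; rewrite !ballEmdist/= => pq.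
by rewrite (le_lt_trans (metric_triangle _ p _))// -ltrBrDl.
Qed.

Lemma subset_of_neighborhoods (A B : set X) : closed B ->
  (forall e, 0 < e -> A `<=` neighborhood e B) -> A `<=` B.
Proof.
move=> cB AB p Ap; apply: cB => U /nbhs_ballP[e /= e0 pU].
by have [b Bb /ball_sym bp] := AB _ e0 _ Ap; exists b; split => //; exact: pU.
Qed.

Lemma hausdorff_lt_subset e A B :
  hausdorff_dist A B < e -> A `<=` neighborhood e B.
Proof.
move=> ABe; have d0 : 0 < e - hausdorff_dist A B by rewrite subr_gt0.
have [r [r0 AB _]] := inf_adherent d0 (hausdorff_radii_has_inf A B).
rewrite -/(hausdorff_dist A B) addrC subrK => re.
by apply: subset_trans AB _; apply: neighborhoodS => //; exact: ltW.
Qed.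

Lemma hausdorff_le e A B : 0 < e ->
  A `<=` neighborhood e B -> B `<=` neighborhood e A -> hausdorff_dist A B <= e.
Proof.
move=> e0 AB BA; apply: ge_inf; last by split.
by exists 0; exact: hausdorff_radii_lbound.
Qed.

Lemma closed_compact (A : set X) : closed A -> compact A.
Proof. by move=> cA; apply: subclosed_compact cA continuum_compact _. Qed.

Lemma near_hausdorff A e : 0 < e -> \forall B \near A, hausdorff_dist A B < e.
Proof. by move=> e0; apply/nbhs_ballP; exists e. Qed.

(* The limit of an ultrafilter of closed sets consists of the points all of
   whose neighbourhoods meet almost all of those sets. *)
Lemma hyperspace_compact : compact [set: hyperspace X].
Proof.
rewrite compact_ultra => F UF _.
pose L := [set p | forall e, 0 < e ->
  F [set A | hyperset A `&` ball p e !=set0]].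
(* If [S] missed [L], each point of [S] would have a ball avoided by almost all sets; compactness of
   [S] would then make almost all sets avoid [S] itself. *)
have meetL (S : set X) : closed S ->
    F [set A | hyperset A `&` S !=set0] -> L `&` S !=set0.
  move=> cS FS; apply: contrapT => LS0.
  have /compact_near_coveringP cov := closed_compact cS.
  have [|A [[p [Ap Sp]] SA]] := filter_ex (filterI FS
    (cov _ F (fun A p => ~ hyperset A p) _ _)).
    move=> p Sp; have : ~ L p by move=> Lp; apply: LS0; exists p.
    move=> /existsNP[e /not_implyP[e0]].
    pose M := [set A | hyperset A `&` ball p e !=set0].
    have [//|nF _] := in_ultra_setVsetC M UF; exists (ball p e, ~` M).
      by split => //; exact: nbhsx_ballx.
    by move=> [q A] /= [pq nA] Aq; apply: nA; exists q.
  exact: SA Sp Ap.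
have cL : closed L.
  move=> p clp e e0; have e20 : 0 < e / 2 by rewrite divr_gt0.
  have [q [Lq pq]] := clp _ (nbhsx_ballx p _ e20).
  apply: filterS (Lq _ e20) => A [r [Ar qr]]; exists r; split => //.
  by rewrite [e]splitr; exact: ball_triangle pq qr.
have L0 : L !=set0.
  have [|p []] := meetL setT closedT; last by exists p.
  apply: filterS filterT => A _; have [a Aa] := hyperset_neq0 A.
  by exists a.
exists (Hyperspace cL L0); split => //= U /nbhs_ballP[e /= e0 LU].
have e20 : 0 < e / 2 by rewrite divr_gt0.
(* The two halves of Hausdorff convergence: [FL] applies [meetL] to the complement of a
   neighbourhood of [L], and [LF] covers the compact set [L] by balls of radius [e / 4]. *)
have FL : F [set A | hyperset A `<=` neighborhood (e / 2) L].
  have [FS|] := in_ultra_setVsetC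
      [set A | hyperset A `&` ~` neighborhood (e / 2) L !=set0] UF.
    have [|p [Lp]] := meetL _ _ FS.
      by apply: open_closedC; exact: open_neighborhood.
    by case; exact: subset_neighborhood.
  apply: filterS => A /= A0 p Ap; apply: contrapT => pL; apply: A0.
  by exists p.
have LF : F [set A | L `<=` neighborhood (e / 2) (hyperset A)].
  have /compact_near_coveringP cov := closed_compact cL.
  apply: (cov _ F (fun A p => neighborhood (e / 2) (hyperset A) p)) => p Lp.
  have e40 : 0 < e / 2 / 2 by rewrite divr_gt0.
  exists (ball p (e / 2 / 2),
    [set A | hyperset A `&` ball p (e / 2 / 2) !=set0]).
    by split; [exact: nbhsx_ballx|exact: Lp].
  move=> [q A] /= [pq [a [Aa pa]]]; exists a => //.
  by rewrite [e / 2]splitr; apply: ball_triangle pq; exact: ball_sym.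
apply: filterS (filterI FL LF) => A [AL LA]; apply: LU.
rewrite ballEmdist/=; apply: (@le_lt_trans _ _ (e / 2)); last first.
  by rewrite ltr_pdivrMr// ltr_pMr// ltr1n.
exact: hausdorff_le.
Qed.

End hyperspace_theory.

(** * Whitney maps *)

Section whitney.
Context {R : realType} {X : continuumType R}.
Implicit Types (A B C K : hyperspace X) (p q x y z : X) (c e : R).

(* The Whitney map is minus the sum over n of 2^-(n+1) times the mean distance
   to the points of a finite 1/(n+1)-net. *)
Definition setdist p A : R := inf [set mdist p a | a in hyperset A].

Lemma setdist_has_inf p A : has_inf [set mdist p a | a in hyperset A].
Proof.
split; first by have [a Aa] := hyperset_neq0 A; exists (mdist p a), a.
by exists 0 => _ [a _ <-]; exact: mdist_ge0.
Qed.

Lemma setdist_le p A a : hyperset A a -> setdist p A <= mdist p a.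
Proof. by move=> Aa; apply: ge_inf; [case: (setdist_has_inf p A)|exists a]. Qed.

Lemma setdist_ge p A e :
  (forall a, hyperset A a -> e <= mdist p a) -> e <= setdist p A.
Proof.
move=> Ae; apply: lb_le_inf; first by case: (setdist_has_inf p A).
by move=> _ [a Aa <-]; exact: Ae.
Qed.

Lemma setdist_subset p A B : hyperset A `<=` hyperset B ->
  setdist p B <= setdist p A.
Proof. by move=> AB; apply: setdist_ge => a /AB; exact: setdist_le. Qed.

Lemma setdist_lipschitz p A B : setdist p A <= setdist p B + hausdorff_dist A B.
Proof.
rewrite -lerBlDr; apply: setdist_ge => b Bb; rewrite lerBlDr.
apply/ler_addgt0Pr => e e0.
have [|a Aa ab] := @hausdorff_lt_subset _ _ (hausdorff_dist A B + e) B A _ _ Bb.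
  by rewrite hausdorff_dist_sym ltrDl.
rewrite (le_trans (setdist_le p Aa))// (le_trans (metric_triangle _ b _))//.
by rewrite -addrA lerD2l metric_sym; move: ab; rewrite ballEmdist => /ltW.
Qed.

(** The gap is strict monotonicity in uniform form: it turns closeness of values on nested sets into
    closeness of the sets. Values at singletons are not normalised to 0, so parameters start at
    [mu (hypersingleton z)]. *)
Record whitney (mu : hyperspace X -> R) : Prop := Whitney {
  whitney_lipschitz : forall A B, `|mu A - mu B| <= hausdorff_dist A B ;
  whitney_le : forall A B, hyperset A `<=` hyperset B -> mu A <= mu B ;
  whitney_gap : forall e, 0 < e -> exists2 d, 0 < d & forall A B,
    hyperset A `<=` hyperset B -> mu B < mu A + d ->
    hyperset B `<=` neighborhood e A }.

(** Adding one to the size avoids division by zero for the empty list and keeps the total weight at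
    most 1, hence the Lipschitz constant too. *)
Definition mean_setdist (F : seq X) A : R :=
  (\sum_(q <- F) setdist q A) / (size F).+1%:R.

Lemma mean_setdist_le_add F A B c : 0 <= c ->
  (forall q, q \in F -> setdist q A <= setdist q B + c) ->
  mean_setdist F A <= mean_setdist F B + c.
Proof.
move=> c0 AB; rewrite /mean_setdist ler_pdivrMr// mulrDl divfK ?pnatr_eq0//.
apply: (@le_trans _ _ (\sum_(q <- F) (setdist q B + c))).
  by rewrite !big_seq; apply: ler_sum.
rewrite big_split/= lerD2l big_const_seq count_predT iter_addr_0 mulr_natr.
by rewrite ler_wpMn2l.
Qed.

Lemma mean_setdist_gap F A B q c : q \in F ->
  hyperset A `<=` hyperset B -> setdist q B + c <= setdist q A ->
  mean_setdist F B + c / (size F).+1%:R <= mean_setdist F A.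
Proof.
move=> qF AB qc; rewrite /mean_setdist -mulrDl ler_pM2r ?invr_gt0//.
rewrite !(big_rem q qF)/= addrAC lerD//.
by apply: ler_sum => r _; exact: setdist_subset.
Qed.

Lemma mean_setdist_le F A c : 0 <= c ->
  (forall q, setdist q A <= c) -> mean_setdist F A <= c.
Proof.
move=> c0 Ac; rewrite /mean_setdist ler_pdivrMr//.
apply: (@le_trans _ _ (\sum_(q <- F) c)); first by apply: ler_sum.
by rewrite big_const_seq count_predT iter_addr_0 mulr_natr ler_wpMn2l.
Qed.

Lemma mean_setdist_ge0 F A : 0 <= mean_setdist F A.
Proof.
rewrite /mean_setdist divr_ge0//; apply: sumr_ge0 => q _.
by apply: setdist_ge => a _; exact: mdist_ge0.
Qed.

(** The first [n] weights add up to [1 - 2^-1 ^+ n], so a termwise error [c] is not amplified. The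
    induction runs on the bound with this exact total. *)
Lemma dyadic_sum_le_add (u v : nat -> R) c n : 0 <= c ->
  (forall k, u k <= v k + c) ->
  \sum_(k < n) 2^-1 ^+ k.+1 * u k <= \sum_(k < n) 2^-1 ^+ k.+1 * v k + c.
Proof.
move=> c0 uv.
have h0 k : 0 <= 2^-1 ^+ k :> R by rewrite exprn_ge0// invr_ge0.
suff : \sum_(k < n) 2^-1 ^+ k.+1 * u k <=
    \sum_(k < n) 2^-1 ^+ k.+1 * v k + c * (1 - 2^-1 ^+ n).
  by move=> /le_trans; apply; rewrite lerD2l ler_piMr// lerBlDr lerDl.
elim: n => [|n IHn]; first by rewrite !big_ord0 expr0 subrr mulr0 addr0.
rewrite !big_ord_recr/=; have := ler_wpM2l (h0 n.+1) (uv n).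
by move: IHn; rewrite exprS; lra.
Qed.

(** Compactness is used along the filter of finite lists directed by inclusion: every list
    containing [p] serves the whole ball around [p]. *)
Lemma finite_net e : 0 < e ->
  exists F : seq X, forall p, exists2 q, q \in F & ball q e p.
Proof.
move=> e0; have /compact_near_coveringP cov := closed_compact (@closedT X).
pose G := filter_from [set: seq X] (fun s => [set t : seq X | {subset s <= t}]).
have FG : ProperFilter G.
  apply: filter_from_proper; last by move=> s _; exists s.
  apply: filter_from_filter; first by exists [::].
  move=> s t _ _; exists (s ++ t) => // u stu.
  by split=> q qs; apply: stu; rewrite mem_cat qs ?orbT.
have [|F coverF] := filter_ex
    (cov _ G (fun F p => exists2 q, q \in F & ball q e p) _ _).
  move=> p _; exists (ball p e, [set t : seq X | {subset [:: p] <= t}]).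
    by split; [exact: nbhsx_ballx|exists [:: p]].
  by move=> [q t] /= [pq pt]; exists p => //; apply: pt; rewrite inE.
by exists F => p; exact: coverF.
Qed.

Lemma exists_whitney : exists mu, whitney mu.
Proof.
have /choice[F F_net] (n : nat) : exists F : seq X,
    forall p, exists2 q, q \in F & ball q n.+1%:R^-1 p.
  by apply: finite_net; rewrite invr_gt0.
pose S A n := \sum_(k < n) 2^-1 ^+ k.+1 * mean_setdist (F k) A.
pose w A : R := sup (range (S A)).
have term_ge0 A k : 0 <= 2^-1 ^+ k.+1 * mean_setdist (F k) A.
  by rewrite mulr_ge0 ?exprn_ge0 ?invr_ge0// mean_setdist_ge0.
have S_has_sup A : has_sup (range (S A)).
  split; first by exists (S A 0%N), 0%N.
  have [a Aa] := hyperset_neq0 A; have [d d0 ad] := continuum_bounded a.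
  exists d => _ [n _ <-].
  have -> : d = \sum_(k < n) 2^-1 ^+ k.+1 * 0 + d.
    by rewrite big1 ?add0r// => k _; rewrite mulr0.
  apply: (@dyadic_sum_le_add (fun k => mean_setdist (F k) A) (fun=> 0)) => [|k].
    exact: ltW.
  rewrite add0r; apply: mean_setdist_le => [|q]; first exact: ltW.
  apply: le_trans (setdist_le q Aa) _; rewrite metric_sym.
  by have := ad q; rewrite ballEmdist => /ltW.
have w_le_add A B c :
    (forall n, exists m, S A n <= S B m + c) -> w A <= w B + c.
  move=> AB; apply: ge_sup; first by case: (S_has_sup A).
  move=> _ [n _ <-]; have [m /le_trans] := AB n; apply.
  by rewrite lerD2r; apply: ub_le_sup; [case: (S_has_sup B)|exists m].
have w_lipschitz A B : w A <= w B + hausdorff_dist A B.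
  have H0 := @mdist_ge0 R (hyperspace X) A B.
  apply: w_le_add => n; exists n.
  apply: (@dyadic_sum_le_add (fun k => mean_setdist (F k) A)
    (fun k => mean_setdist (F k) B)) => // k.
  by apply: mean_setdist_le_add => // q _; exact: setdist_lipschitz.
exists (fun A => - w A); split.
- move=> A B; have := w_lipschitz A B; have := w_lipschitz B A.
  by rewrite hausdorff_dist_sym ler_norml => ? ?; apply/andP; split; lra.
- move=> A B AB; rewrite lerN2 -[w A]addr0; apply: w_le_add => n; exists n.
  apply: (@dyadic_sum_le_add (fun k => mean_setdist (F k) B)
    (fun k => mean_setdist (F k) A)) => // k.
  apply: mean_setdist_le_add => // q _.
  by rewrite addr0; exact: setdist_subset.
- move=> e e0.
  have e40 : 0 < e / 4 by rewrite divr_gt0.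
  have [n ne] : exists n, n.+1%:R^-1 < e / 4.
    exists (Num.truncn (e / 4)^-1).
    by rewrite invf_plt ?posrE// truncnS_gt.
  (* If [b] in [B] is at distance at least [e] from [A] and the net point [q] is within [e / 4] of
     [b], then [setdist q] drops by at least [e / 4] from [A] to [B]; [c] is the effect of this drop
     on the term of index [n]. *)
  pose c := 2^-1 ^+ n.+1 * (e / 4 / (size (F n)).+1%:R).
  have c0 : 0 < c by rewrite mulr_gt0 ?exprn_gt0 ?invr_gt0// divr_gt0.
  exists c => // A B AB wAB; apply: contrapT => BA.
  have [b Bb nAb] : exists2 b, hyperset B b & ~ neighborhood e A b.
    apply: contrapT => nex; apply: BA => b Bb; apply: contrapT => nAb.
    by apply: nex; exists b.
  have [q qF qb] := F_net n b.
  have qb4 : mdist q b < e / 4.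
    by move: qb; rewrite ballEmdist/= => /lt_trans; apply.
  have qAB : setdist q B + e / 4 <= setdist q A.
    apply: setdist_ge => a Aa; have := setdist_le q Bb.
    have : e <= mdist a b.
      rewrite leNgt; apply/negP => ab; apply: nAb; exists a => //.
      by rewrite ballEmdist.
    have := metric_triangle a q b; rewrite (metric_sym a q).
    by move: qb4; lra.
  have : w B + c <= w A.
    suff : w B <= w A - c by rewrite lerBrDr.
    (* Only partial sums that include index [n] show the drop, hence a length of at least [n.+1];
       the terms are nonnegative, so lengthening the sum for [B] only increases it. *)
    apply: w_le_add => m; exists (maxn m n.+1).
    apply: (@le_trans _ _ (S B (maxn m n.+1))).
      rewrite -(subnKC (leq_maxl m n.+1)) /S big_split_ord/= lerDl.
      by apply: sumr_ge0 => k _; exact: term_ge0.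
    have nm : (n < maxn m n.+1)%N by rewrite leq_max ltnSn orbT.
    rewrite /S (bigD1 (Ordinal nm))//= [in leRHS](bigD1 (Ordinal nm))//=.
    have Dn : 2^-1 ^+ n.+1 * mean_setdist (F n) B + c <=
        2^-1 ^+ n.+1 * mean_setdist (F n) A.
      rewrite /c -mulrDr; apply: ler_wpM2l; last exact: mean_setdist_gap qAB.
      by rewrite exprn_ge0// invr_ge0.
    rewrite addrAC; apply: lerD; first by rewrite lerBrDr.
    apply: ler_sum => k _; apply: ler_wpM2l.
      by rewrite exprn_ge0// invr_ge0.
    rewrite -[leRHS]addr0; apply: mean_setdist_le_add => // r _.
    by rewrite addr0; exact: setdist_subset.
  by move: wAB; rewrite ltNge => /negP + ?; apply; lra.
Qed.

End whitney.

(** * Growth inside a continuum and order arcs *)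

Lemma ultra_fmap (T V : Type) (f : T -> V) (F : set_system T) :
  UltraFilter F -> UltraFilter (f @ F).
Proof.
move=> UF; split; first exact: fmap_proper_filter.
move=> G GF fFG; apply/seteqP; split=> [A GA|]; last exact: fFG.
have [//|nA] := in_ultra_setVsetC (f @^-1` A) UF.
by have [p []] := filter_ex (filterI GA (fFG (~` A) nA)).
Qed.

Section order_arcs.
Context {R : realType} {X : continuumType R}.
Implicit Types (A B C K : hyperspace X) (p q x y z : X) (c e u v : R).
Context (mu : hyperspace X -> R) (mu_whitney : whitney mu).

(** A nonpositive increment of [mu] is below every [d], so the gap puts [B] in every neighbourhood
    of the closed set [A]. *)
Lemma whitney_eq A B : hyperset A `<=` hyperset B -> mu B <= mu A -> A = B.
Proof.
move=> AB BA; apply: hyperset_inj; apply/seteqP; split => //.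
apply: subset_of_neighborhoods (hyperset_closed (h := A)) _ => e.
move=> /(whitney_gap mu_whitney)[d d0]; apply => //.
by rewrite (le_lt_trans BA)// ltrDl.
Qed.

(** The closure keeps the set closed, which costs a second [e] in the Hausdorff estimate; the
    separate summand [A] makes growth increasing even if [A] is not inside [K]. *)
Definition grow_set K e A : set X :=
  hyperset A `|` (hyperset K `&` closure (neighborhood e (hyperset A))).

Lemma grow_set_closed K e A : closed (grow_set K e A).
Proof.
by apply: closedU; [exact: hyperset_closed|apply: closedI;
  [exact: hyperset_closed|exact: closed_closure]].
Qed.

Lemma grow_set_neq0 K e A : grow_set K e A !=set0.
Proof. by have [a Aa] := hyperset_neq0 A; exists a; left. Qed.

Definition grow K e A :=
  Hyperspace (@grow_set_closed K e A) (grow_set_neq0 K e A).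

Lemma hausdorff_grow K e A : 0 < e -> hausdorff_dist A (grow K e A) <= e + e.
Proof.
move=> e0; have ee0 : 0 < e + e by exact: addr_gt0.
apply: hausdorff_le => // p; first by move=> Ap; exists p; [left|exact: ballxx].
move=> [|[_ /(_ _ (nbhsx_ballx p _ e0))[q [[a Aa aq] pq]]]].
  exact: subset_neighborhood.
by exists a => //; apply: ball_triangle aq _; exact: ball_sym.
Qed.

(* The union of the iterates is relatively clopen in K. *)
Lemma grow_exhausts K z e : 0 < e -> connected (hyperset K) -> hyperset K z ->
  exists n, iter n (grow K e) (hypersingleton z) = K.
Proof.
move=> e0 Kconn Kz; pose s n := iter n (grow K e) (hypersingleton z).
have sK n : hyperset (s n) `<=` hyperset K.
  elim: n => [|n IHn] p; first by move=> ->.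
  by move=> [/IHn|[]].
have s_mono m n : (m <= n)%N -> hyperset (s m) `<=` hyperset (s n).
  move=> /subnK <-; elim: (n - m)%N => // k IHk p /IHk; left; assumption.
have sS n p : hyperset K p -> neighborhood e (hyperset (s n)) p ->
    hyperset (s n.+1) p.
  by move=> Kp np; right; split => //; exact: subset_closure.
pose U := \bigcup_n neighborhood e (hyperset (s n)).
have UE p : hyperset K p -> U p -> exists n, hyperset (s n) p.
  by move=> Kp [n _ np]; exists n.+1; exact: sS.
have KU : hyperset K `&` U = hyperset K.
  apply: Kconn; first by exists z; split => //; exists 0%N => //;
    exact: subset_neighborhood.
    by exists U => //; apply: bigcup_open => n _; exact: open_neighborhood.
  (* A point of [K] in the closure of the union is within [e] of some iterate, so it is already in
     [U]. *)
  exists (closure (hyperset K `&` U)); first exact: closed_closure.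
  apply/seteqP; split=> p.
    by move=> KUp; split; [case: KUp|exact: subset_closure].
  move=> [Kp /(_ _ (nbhsx_ballx p _ e0))[q [[Kq Uq] pq]]]; split => //.
  have [n snq] := UE _ Kq Uq; exists n => //.
  by exists q => //; exact: ball_sym.
have /compact_near_coveringP cov := closed_compact (hyperset_closed (h := K)).
have [|n Kn] := filter_ex
    (cov _ \oo (fun n p => hyperset K p -> hyperset (s n) p) _ _).
  move=> p Kp; have [n snp] : exists n, hyperset (s n) p.
    by apply: UE => //; move: Kp; rewrite -{1}KU => -[].
  (* One further step after [p] is reached absorbs the [e]-ball of [p] in [K], hence [n < m]. *)
  exists (ball p e, [set m | (n < m)%N]).
    by split; [exact: nbhsx_ballx|exact: nbhs_infty_gt].
  move=> [q m] /= [pq nm] Kq; apply: (s_mono _ _ nm); apply: sS => //.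
  by exists p.
exists n; apply: hyperset_inj; apply/seteqP; split; first exact: sK.
by move=> p Kp; exact: Kn.
Qed.

(** [D v] is the first iterate of [grow K (e / 2)] at which [mu] reaches [v]. One step moves a set
    by at most [e] and [mu] is 1-Lipschitz, so the overshoot is at most [e]. *)
Lemma approximate_growth K z e : 0 < e -> connected (hyperset K) ->
  hyperset K z -> exists D : R -> hyperspace X,
  forall v, mu (hypersingleton z) <= v <= mu K ->
    [/\ v <= mu (D v) <= v + e, hyperset (D v) z, hyperset (D v) `<=` hyperset K
      & forall u, mu (hypersingleton z) <= u <= v ->
          hyperset (D u) `<=` hyperset (D v)].
Proof.
move=> e0 Kconn Kz; have e20 : 0 < e / 2 by rewrite divr_gt0.
have [N sN] := grow_exhausts e20 Kconn Kz.
pose s n := iter n (grow K (e / 2)) (hypersingleton z).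
have s_mono m n : (m <= n)%N -> hyperset (s m) `<=` hyperset (s n).
  by move=> /subnK <-; elim: (n - m)%N => // k IHk p /IHk; left.
have /choice[i iP] v : exists i, v <= mu K ->
    v <= mu (s i) /\ forall j, (j < i)%N -> mu (s j) < v.
  have [vK|vK] := boolP (v <= mu K); last by exists 0%N.
  have ex : exists n, v <= mu (s n) by exists N; rewrite /s sN.
  exists (ex_minn ex) => _; case: ex_minnP => n vn n_min; split => // j jn.
  by rewrite ltNge; apply: contraL jn => /n_min; rewrite -leqNgt.
exists (s \o i) => v /andP[zv vK] /=; have [vi i_min] := iP v vK; split.
- rewrite vi; case: (i v) i_min => [_|n /(_ _ (ltnSn n)) snv].
    by rewrite (le_trans zv)// lerDl ltW.
  have := whitney_lipschitz mu_whitney (s n) (s n.+1).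
  have := hausdorff_grow K (s n) e20; rewrite -/(s n.+1) -splitr ler_norml.
  by move=> H /andP[+ _]; move: H snv; rewrite /s/=; lra.
- exact: (s_mono 0%N).
- move=> p /(s_mono _ (maxn (i v) N) (leq_maxl _ _)); rewrite -sN.
  elim: (maxn _ _) => [|n IHn]; first by move=> ->; rewrite sN.
  by move=> [/IHn|[]] //; rewrite sN.
- move=> u /andP[zu uv]; apply: s_mono.
  have [_ u_min] := iP u (le_trans uv vK).
  by rewrite leqNgt; apply/negP => /u_min; rewrite ltNge (le_trans uv vi).
Qed.

(* The ultralimit of the approximate growths of step 1/n: the value of mu is
   prescribed at each parameter, hence survives in the limit. *)
Lemma growth K z : connected (hyperset K) ->
  hyperset K z -> exists L : R -> hyperspace X,
  forall v, mu (hypersingleton z) <= v <= mu K ->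
    [/\ mu (L v) = v, hyperset (L v) z, hyperset (L v) `<=` hyperset K
      & forall u, mu (hypersingleton z) <= u <= v ->
          hyperset (L u) `<=` hyperset (L v)].
Proof.
move=> Kconn Kz.
have n1 (n : nat) : 0 < n.+1%:R^-1 :> R by rewrite invr_gt0.
have /choice[D DP] n := approximate_growth (n1 n) Kconn Kz.
(* A single ultrafilter on the indices serves all parameters at once, so limits at [u] and [v] can
   be compared through a common [n]. *)
have [U [UU ooU]] := @ultraFilterLemma _ \oo eventually_filter.
have := @hyperspace_compact R X; rewrite compact_ultra => cpt.
have /choice[L LP] v : exists A, (D ^~ v) @ U --> A.
  have [A [_ DA]] := cpt _ (ultra_fmap (fun n => D n v) UU) filterT.
  by exists A.
have LD e v : 0 < e -> U [set n | hausdorff_dist (L v) (D n v) < e].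
  by move=> e0; exact: (LP v _ (near_hausdorff (L v) e0)).
have Uex (P : set nat) : U P -> exists n, P n by move=> /filter_ex.
exists L => v vzK; split.
- apply/eqP; rewrite -subr_eq0 -normr_le0; apply/ler_addgt0Pr => /= e e0.
  have e20 : 0 < e / 2 by rewrite divr_gt0.
  have [n [/= Hn ne]] := Uex _ (filterI (LD _ v e20)
    (ooU _ (near_infty_natSinv_lt (PosNum e20)))).
  have [/andP[Dv1 Dv2] _ _ _] := DP n v vzK.
  have := whitney_lipschitz mu_whitney (L v) (D n v).
  have {}ne : n.+1%:R^-1 < e / 2 := ne.
  have ve : mu (D n v) <= v + e / 2 by rewrite (le_trans Dv2)// lerD2l ltW.
  by move: Hn; rewrite !ler_norml => ? /andP[? ?]; apply/andP; split; lra.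
- suff : [set z] `<=` hyperset (L v) by apply.
  apply: subset_of_neighborhoods (hyperset_closed (h := L v)) _ => e e0 _ ->.
  have [n] := Uex _ (LD _ v e0); rewrite /= hausdorff_dist_sym.
  by move=> /hausdorff_lt_subset; apply; have [] := DP n v vzK.
- apply: subset_of_neighborhoods (hyperset_closed (h := K)) _ => e e0.
  have [n] := Uex _ (LD _ v e0).
  move=> /hausdorff_lt_subset /subset_trans; apply; apply: neighborhoodS => //.
  by have [] := DP n v vzK.
- move=> u uzv; apply: subset_of_neighborhoods (hyperset_closed (h := L v)) _.
  move=> e e0; have e20 : 0 < e / 2 by rewrite divr_gt0.
  have [n [/= Hu Hv]] := Uex _ (filterI (LD _ u e20) (LD _ v e20)).
  rewrite [e]splitr; apply: (@neighborhood_trans _ _ _ _ _ (hyperset (D n v))).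
    apply: subset_trans (hausdorff_lt_subset Hu) _; apply: neighborhoodS => //.
    by have [_ _ _] := DP n v vzK; apply.
  by apply: hausdorff_lt_subset; rewrite hausdorff_dist_sym.
Qed.

Lemma within01P (f : R -> hyperspace X) :
  {within `[0, 1], continuous f} <->
  forall t, 0 <= t <= 1 -> forall e, 0 < e -> exists2 d, 0 < d &
    forall s, 0 <= s <= 1 -> `|s - t| < d -> hausdorff_dist (f t) (f s) < e.
Proof.
rewrite subspace_continuousP; split=> f_cont t t01.
  move=> e e0; have := f_cont t; rewrite /= in_itv/= => /(_ t01).
  move=> /(_ _ (near_hausdorff (f t) e0)); rewrite /= nbhs_simpl /within/=.
  move=> /nbhs_ballP[d /= d0 td]; exists d => // s s01 st.
  by apply: td; rewrite /= ?in_itv//= /ball/= distrC.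
move: t01; rewrite /= in_itv/= => t01 V /nbhs_ballP[e /= e0 eV].
have [d d0 td] := f_cont t t01 e e0.
rewrite /= nbhs_simpl /within/=; apply/nbhs_ballP; exists d => //= s.
rewrite /ball/= distrC in_itv/= => st s01; apply: eV.
by rewrite ballEmdist/=; exact: td.
Qed.

(** On a chain [mu] is injective, so [alpha t] is the unique member with value
    [mu A + t * (mu B - mu A)]; the gap makes this inverse of [mu] uniformly continuous. *)
Lemma chain_order_arc (chain : set (hyperspace X)) A B :
  chain A -> chain B -> hyperset A `<` hyperset B ->
  (forall C D, chain C -> chain D ->
    hyperset C `<=` hyperset D \/ hyperset D `<=` hyperset C) ->
  (forall v, mu A <= v <= mu B -> exists2 C, chain C & mu C = v) ->
  exists alpha, [/\ order_arc alpha, alpha 0 = A, alpha 1 = B &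
    forall t, 0 <= t <= 1 -> chain (alpha t)].
Proof.
move=> chA chB [AB BA] chain_total mu_onto.
have mu_lt : mu A < mu B.
  rewrite ltNge; apply/negP => mBA; apply: BA.
  by rewrite (whitney_eq AB mBA).
have chain_le C D : chain C -> chain D -> mu C <= mu D ->
    hyperset C `<=` hyperset D.
  move=> chC chD CD; have [//|DC] := chain_total _ _ chC chD.
  by rewrite (whitney_eq DC CD).
have chain_inj C D : chain C -> chain D -> mu C = mu D -> C = D.
  move=> chC chD CD; apply: hyperset_inj; apply/seteqP.
  by split; apply: chain_le => //; rewrite CD.
pose g t := mu A + t * (mu B - mu A).
have /choice[alpha alphaP] t : exists C, 0 <= t <= 1 -> chain C /\ mu C = g t.
  have [t01|t01] := boolP (0 <= t <= 1); last by exists A.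
  have [|C chC Ct] := mu_onto (g t); last by exists C.
  by rewrite /g; apply/andP; split; nra.
have g_lt s t : s < t -> g s < g t by rewrite /g; nra.
have ch_alpha t : 0 <= t <= 1 -> chain (alpha t) by case/alphaP.
have mu_alpha t : 0 <= t <= 1 -> mu (alpha t) = g t by case/alphaP.
exists alpha; split => //.
- split.
    apply/within01P => t t01 e e0.
    have e20 : 0 < e / 2 by rewrite divr_gt0.
    have [d d0 gap] := whitney_gap mu_whitney e20.
    have dl0 : 0 < d / (mu B - mu A) by rewrite divr_gt0// subr_gt0.
    exists (d / (mu B - mu A)) => // s s01 st.
    (* For [u <= v] the sets are nested the right way; otherwise their values differ by less than
       [d] and the gap applies. *)
    have near_subset u v : 0 <= u <= 1 -> 0 <= v <= 1 ->
        `|u - v| < d / (mu B - mu A) ->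
        hyperset (alpha u) `<=` neighborhood (e / 2) (hyperset (alpha v)).
      move=> u01 v01 uv.
      have [uv_le|/ltW vu_le] := leP u v.
        apply: subset_trans (subset_neighborhood e20).
        apply: chain_le; [exact: ch_alpha|exact: ch_alpha|].
        rewrite !mu_alpha//; move: uv_le; rewrite le_eqVlt => /predU1P[->//|].
        by move=> /g_lt/ltW.
      apply: gap.
        apply: chain_le; [exact: ch_alpha|exact: ch_alpha|].
        rewrite !mu_alpha//; move: vu_le; rewrite le_eqVlt => /predU1P[->//|].
        by move=> /g_lt/ltW.
      rewrite !mu_alpha// /g; move: uv.
      by rewrite ltr_pdivlMr ?subr_gt0// ger0_norm ?subr_ge0//; lra.
    apply: (@le_lt_trans _ _ (e / 2)).
      by apply: hausdorff_le => //; apply: near_subset; rewrite // distrC.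
    by rewrite ltr_pdivrMr// ltr_pMr// ltr1n.
  move=> s t s0 st t1.
  have s01 : 0 <= s <= 1 by rewrite s0 (ltW (lt_le_trans st t1)).
  have t01 : 0 <= t <= 1 by rewrite (le_trans s0 (ltW st)).
  split.
    by apply: chain_le; [exact: ch_alpha|exact: ch_alpha|
      rewrite !mu_alpha// ltW// g_lt].
  move=> /(whitney_le mu_whitney); rewrite !mu_alpha//.
  by rewrite leNgt g_lt.
- apply: chain_inj => //; first by apply: ch_alpha; rewrite lexx ler01.
  by rewrite mu_alpha ?lexx ?ler01// /g mul0r addr0.
- apply: chain_inj => //; first by apply: ch_alpha; rewrite lexx ler01.
  by rewrite mu_alpha ?lexx ?ler01// /g mul1r addrC subrK.
Qed.

End order_arcs.

(** * Unions along a path in $2^X$ *)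

Section swept.
Context {R : realType} {X : continuumType R}.
Implicit Types (A B C K : hyperspace X) (p q x y z : X) (e s t : R).

(** By compactness of [A], one radius [e] works for all its points. *)
Lemma open_hyper_subset (O : set X) :
  open O -> open [set A : hyperspace X | hyperset A `<=` O].
Proof.
move=> oO; rewrite openE => A /= AO.
have /compact_near_coveringP cov := closed_compact (hyperset_closed (h := A)).
have [|e [e0 eO]] := filter_ex (filterI (nbhs_right_gt (0 : R))
    (cov _ (0 : R)^'+ (fun e p => ball p e `<=` O) _ _)).
  move=> p /AO Op; have /nbhs_ballP[e /= e0 pO] : nbhs p O.
    exact: open_nbhs_nbhs.
  exists (ball p (e / 2), [set d | d < e / 2]).
    split; first by apply: nbhsx_ballx; rewrite divr_gt0.
    by apply: nbhs_right_lt; rewrite divr_gt0.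
  move=> [q d] /= [pq de] r qr; apply: pO; rewrite [e]splitr.
  by apply: ball_triangle pq _; apply: le_ball qr; exact: ltW.
apply/nbhs_ballP; exists e => // B; rewrite ballEmdist/= => AB p.
have : hausdorff_dist B A < e by rewrite hausdorff_dist_sym.
by move=> /hausdorff_lt_subset /[apply] -[a Aa]; exact: eO.
Qed.

Lemma closed_hyper_subset (F : set X) :
  closed F -> closed [set A : hyperspace X | hyperset A `<=` F].
Proof.
move=> cF A clA; apply: subset_of_neighborhoods cF _ => e e0.
have [B [/= BF AB]] := clA _ (near_hausdorff A e0).
apply: subset_trans (hausdorff_lt_subset AB) _.
exact: neighborhoodS.
Qed.

Definition swept_set (f : R -> hyperspace X) t : set X :=
  \bigcup_(s in `[0, t]) hyperset (f s).

Context (f : R -> hyperspace X) (f_cont : {within `[0, 1], continuous f}).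

(** A point outside [f s] has a neighbourhood missing [f r] for all [r] near [s]; compactness of
    [[0, t]] yields one neighbourhood for all parameters. *)
Lemma swept_set_closed t : t <= 1 -> closed (swept_set f t).
Proof.
move=> t1 p clp; apply: contrapT => np.
have /compact_near_coveringP/near_covering_withinP cov :=
  @segment_compact R 0 t.
have : \forall q \near p, `[0, t] `<=` [set s | ~ hyperset (f s) q].
  apply: (cov _ (nbhs p) (fun q s => ~ hyperset (f s) q)) => s.
  rewrite /= in_itv/= => /andP[s0 st].
  have s01 : 0 <= s <= 1 by rewrite s0 (le_trans st).
  have fsp : ~ hyperset (f s) p.
    by move=> fsp; apply: np; exists s => //=; rewrite in_itv/= s0.
  have [e e0 pe] : exists2 e, 0 < e & ~ neighborhood e (hyperset (f s)) p.
    apply: contrapT => ne; apply: fsp.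
    suff : [set p] `<=` hyperset (f s) by apply.
    apply: subset_of_neighborhoods (hyperset_closed (h := f s)) _.
    move=> e e0 _ ->; apply: contrapT => pe; apply: ne; by exists e.
  have e20 : 0 < e / 2 by rewrite divr_gt0.
  have [d d0 sd] := (within01P f).1 f_cont s s01 _ e20.
  exists (ball s d, ball p (e / 2)).
    by split; exact: nbhsx_ballx.
  move=> [r q] /= [sr pq]; rewrite in_itv/= => /andP[r0 rt] frq; apply: pe.
  have r01 : 0 <= r <= 1 by rewrite r0 (le_trans rt).
  have := sd r r01; rewrite distrC => /(_ sr); rewrite hausdorff_dist_sym.
  move=> /hausdorff_lt_subset/(_ _ frq)[a fsa aq]; exists a => //.
  by rewrite [e]splitr; apply: ball_triangle aq _; exact: ball_sym.
move=> /clp[q [[s s0t fsq] nq]]; exact: nq fsq.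
Qed.

(** The sets [f s] may be disconnected; the singleton [f 0] anchors the argument. Given a relatively
    clopen part containing [y], the members of the path inside it form a nonempty clopen subset of
    the connected image of [[0, t]], so all members lie inside it. *)
Lemma swept_set_connected y t : 0 <= t <= 1 -> f 0 = hypersingleton y ->
  connected (swept_set f t).
Proof.
move=> /andP[t0 t1] f0.
have y0 : swept_set f t y by exists 0; rewrite /= ?in_itv/= ?lexx ?t0 ?f0.
have conn : connected (f @` `[0, t]).
  apply: connected_continuous_connected; first exact: segment_connected.
  apply: continuous_subspaceW f_cont => s /=; rewrite !in_itv/= => /andP[-> st].
  exact: le_trans st t1.
have clopen_sub (O F : set X) : open O -> closed F ->
    swept_set f t `&` O = swept_set f t `&` F -> O y -> swept_set f t `<=` O.
  move=> oO cF OF Oy.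
  have sub s : `[0, t]%classic s -> hyperset (f s) `<=` swept_set f t.
    by move=> s0t p fsp; exists s.
  (* [O] and [F] agree on the swept set, so containment of [f s] in [O] is both an open and a closed
     condition. *)
  have sOF s : `[0, t]%classic s ->
      (hyperset (f s) `<=` O) = (hyperset (f s) `<=` F).
    move=> s0t; apply/propext; split=> fs p fsp.
      have : (swept_set f t `&` O) p by split; [exact: sub fsp|exact: fs].
      by rewrite OF => -[].
    have : (swept_set f t `&` F) p by split; [exact: sub fsp|exact: fs].
    by rewrite -OF => -[].
  have E : f @` `[0, t] `&` [set A : hyperspace X | hyperset A `<=` O] =
      f @` `[0, t].
    apply: conn.
    - exists (f 0); split; last by rewrite /= f0 => _ ->.
      by exists 0; rewrite //= in_itv/= lexx t0.
    - by exists [set A : hyperspace X | hyperset A `<=` O] => //;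
        exact: open_hyper_subset.
    - exists [set A : hyperspace X | hyperset A `<=` F].
        exact: closed_hyper_subset.
      apply/seteqP; split=> _ [[s s0t <-]] /= fs; split; try by exists s.
        by rewrite /= -sOF.
      by rewrite /= sOF.
  move=> p [s s0t fsp].
  have : (f @` `[0, t]) (f s) by exists s.
  by rewrite -E => -[_ /= /(_ p fsp)].
move=> B [b Bb] [O oO BO] [F cF BF].
have OF : swept_set f t `&` O = swept_set f t `&` F by rewrite -BO.
have [Oy|nOy] := pselect (O y).
  by rewrite BO; apply/setIidPl; exact: clopen_sub OF Oy.
(* Here [y] lies outside [B]. The complement of [B] is relatively clopen too, hence everything,
   which contradicts [b]. *)
have : swept_set f t `<=` ~` F.
  apply: (clopen_sub _ (~` O)).
  - exact: closed_openC.
  - exact: open_closedC.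
  - apply/seteqP; split=> p [Cp np]; split => // Op; apply: np.
      by have : (swept_set f t `&` O) p by []; rewrite OF => -[].
    by have : (swept_set f t `&` F) p by []; rewrite -OF => -[].
  - move=> Fy; apply: nOy.
    by have : (swept_set f t `&` F) y by []; rewrite -OF => -[].
by move: Bb; rewrite BF => -[Cb Fb] /(_ b Cb).
Qed.

End swept.

(** * Blocked points and nonblockers *)

Section blocked_points.
Context {R : realType} {X : continuumType R}.
Implicit Types (A B C K : hyperspace X) (p q x y z : X) (e s t u v : R).

Lemma exists_swept y (f : R -> hyperspace X) :
  {within `[0, 1], continuous f} -> f 0 = hypersingleton y ->
  exists C : R -> hyperspace X,
    forall t, 0 <= t <= 1 -> hyperset (C t) = swept_set f t.
Proof.
move=> f_cont f0.
have /choice[C CP] t : exists A : hyperspace X,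
    0 <= t <= 1 -> hyperset A = swept_set f t.
  have [/andP[t0 t1]|] := boolP (0 <= t <= 1); last by exists (f 0).
  have cl := swept_set_closed f_cont t1.
  have ne : swept_set f t !=set0.
    by exists y; exists 0; rewrite /= ?in_itv/= ?lexx ?t0 ?f0.
  by exists (Hyperspace cl ne).
by exists C.
Qed.

Lemma swept_set_mono (f : R -> hyperspace X) s t :
  s <= t -> swept_set f s `<=` swept_set f t.
Proof.
move=> st p [r]; rewrite /= in_itv/= => /andP[r0 rs] frp.
by exists r => //=; rewrite in_itv/= r0 (le_trans rs).
Qed.

(** The intermediate value theorem for [mu \o C], whose continuity comes from that of [f]. *)
Lemma swept_onto (mu : hyperspace X -> R) (f C : R -> hyperspace X) a v :
  whitney mu -> {within `[0, 1], continuous f} ->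
  (forall t, 0 <= t <= 1 -> hyperset (C t) = swept_set f t) ->
  0 <= a <= 1 -> mu (C a) <= v <= mu (C 1) ->
  exists2 t, a <= t <= 1 & mu (C t) = v.
Proof.
move=> mu_whitney f_cont CE /andP[a0 a1] v_mid.
(* Every set [f r] added between [s] and [t] is within [e] of some earlier [f r'], which bounds the
   Hausdorff distance of the two unions. *)
have near_le e s t : 0 < e -> 0 <= s <= 1 -> 0 <= t <= 1 -> s <= t ->
    (forall r, s <= r <= t -> exists2 r', r' <= s & 0 <= r' <= 1 /\
      hausdorff_dist (f r') (f r) < e) ->
    `|mu (C t) - mu (C s)| <= e.
  move=> e0 s01 t01 st near_st.
  apply: le_trans (whitney_lipschitz mu_whitney _ _) _.
  apply: hausdorff_le; rewrite // !CE//; last first.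
    apply: subset_trans (swept_set_mono st) _; exact: subset_neighborhood.
  move=> p [r]; rewrite /= in_itv/= => /andP[r0 rt] frp.
  have [rs|/ltW sr] := leP r s.
    apply: subset_neighborhood => //; exists r => //=.
    by rewrite in_itv/= r0.
  have [|r' r's [/andP[r'0 _] ff]] := near_st r; first by rewrite sr.
  have /hausdorff_lt_subset/(_ _ frp)[q fq qp] :
    hausdorff_dist (f r) (f r') < e by rewrite hausdorff_dist_sym.
  by exists q => //; exists r' => //=; rewrite in_itv/= r'0.
have mu_cont : {within `[a, 1], continuous (mu \o C)}.
  rewrite subspace_continuousP => t; rewrite /= in_itv/= => /andP[at_ t1].
  have t01 : 0 <= t <= 1 by rewrite (le_trans a0 at_).
  apply/cvgrPdist_lt => e e0; have e20 : 0 < e / 2 by rewrite divr_gt0.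
  have e40 : 0 < e / 2 / 2 by rewrite divr_gt0.
  have [d d0 td] := (within01P f).1 f_cont t t01 _ e40.
  apply/nbhs_ballP; exists d => //= s.
  rewrite /ball/= in_itv/= => ts /andP[as_ s1].
  have s01 : 0 <= s <= 1 by rewrite (le_trans a0 as_).
  apply: (@le_lt_trans _ _ (e / 2)); last first.
    by rewrite ltr_pdivrMr// ltr_pMr// ltr1n.
  move: ts; rewrite ltr_distlC => /andP[ts1 ts2].
  (* Continuity is known at [t]. If [s <= t], then [f s] and [f r] are compared through [f t], at
     [e / 4] each; otherwise [f r] is compared with [f t] directly. *)
  have [st|/ltW ts] := leP s t.
    apply: near_le => // r /andP[sr rt]; exists s => //; split => //.
    apply: (le_lt_trans (hausdorff_dist_triangle (f t) _ _)).
    rewrite [e / 2]splitr ltrD//.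
      rewrite hausdorff_dist_sym td// distrC ltr_distlC.
      by apply/andP; split; lra.
    apply: td; first by rewrite (le_trans _ sr) ?(le_trans rt); case/andP: s01.
    by rewrite distrC ltr_distlC; apply/andP; split; lra.
  rewrite distrC; apply: near_le => // r /andP[tr rs].
  exists t => //; split => //.
  apply: (@lt_trans _ _ (e / 2 / 2)); last first.
    by rewrite ltr_pdivrMr// ltr_pMr// ltr1n.
  apply: td; first by rewrite (le_trans _ tr) ?(le_trans rs); case/andP: t01.
  by rewrite distrC ltr_distlC; apply/andP; split; lra.
have [|t] := @IVT R (mu \o C) a 1 v a1 mu_cont.
  have C_le : mu (C a) <= mu (C 1).
    by case/andP: v_mid; exact: le_trans.
  by rewrite /= (min_idPl C_le) (max_idPr C_le).
by rewrite in_itv/= => a_t1 Ctv; exists t.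
Qed.

Lemma blocked_points_refl x : blocked_points x x.
Proof.
move=> [f [_ f0 _ /(_ 0)]]; rewrite lexx ltr01 f0 => /(_ isT) E.
by have : ([set x] `&` [set x]) x by []; rewrite E.
Qed.

(** * From a path avoiding [x] to an order arc avoiding $B(x)$ *)

Section unblocked_path.
Context (x y : X) (f C : R -> hyperspace X)
  (f_cont : {within `[0, 1], continuous f})
  (f0 : f 0 = hypersingleton y) (f1 : f 1 = hyperfull)
  (fx : forall t, 0 <= t < 1 -> hyperset (f t) `&` hypersingleton x = set0)
  (CE : forall t, 0 <= t <= 1 -> hyperset (C t) = swept_set f t).

Let C_connected t : 0 <= t <= 1 -> connected (hyperset (C t)).
Proof. by move=> t01; rewrite CE//; exact: swept_set_connected t01 f0. Qed.

Let C_notin t : 0 <= t < 1 -> ~ hyperset (C t) x.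
Proof.
move=> /andP[t0 t1]; rewrite CE ?t0 ?ltW// => -[s].
rewrite /= in_itv/= => /andP[s0 st] fsx.
have : (hyperset (f s) `&` hypersingleton x) x by [].
by rewrite fx// s0 (le_lt_trans st).
Qed.

Let C0 : C 0 = hypersingleton y.
Proof.
apply: hyperset_inj; rewrite CE ?lexx ?ler01//.
apply/seteqP; split=> [p [s]|p py].
  by rewrite /= in_itv/= => /le_anti <-; rewrite f0.
by exists 0; rewrite ?f0//= in_itv/= lexx.
Qed.

Let C1 : C 1 = hyperfull.
Proof.
apply: hyperset_inj; rewrite CE ?lexx ?ler01//.
apply/seteqP; split=> p // _; exists 1; last by rewrite f1.
by rewrite /= in_itv/= lexx ler01.
Qed.

Let C_total s t : 0 <= s <= 1 -> 0 <= t <= 1 ->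
  hyperset (C s) `<=` hyperset (C t) \/ hyperset (C t) `<=` hyperset (C s).
Proof.
move=> s01 t01; rewrite !CE//.
by have [st|/ltW ts] := leP s t; [left|right]; exact: swept_set_mono.
Qed.

Let proper_full z : z <> x ->
  hyperset (hypersingleton z) `<` hyperset (@hyperfull R X).
Proof. by move=> zx; split => // /(_ x Logic.I) /esym. Qed.

(* A point z of C t0 is joined to C t0 by an order arc avoiding x, and the
   sets C t with t >= t0 continue it up to X. *)
Lemma swept_not_blocked t0 z : 0 <= t0 < 1 -> hyperset (C t0) z ->
  ~ blocked_points x z.
Proof.
move=> /andP[t0_ge0 t0_lt1] Cz; apply.
have t01 : 0 <= t0 <= 1 by rewrite t0_ge0 ltW.
have [mu mu_whitney] := @exists_whitney R X.
have [L LP] := growth mu_whitney (C_connected t01) Cz.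
have zC : mu (hypersingleton z) <= mu (C t0).
  by apply: whitney_le => // p ->.
pose chain : set (hyperspace X) :=
  [set A | (exists2 v, mu (hypersingleton z) <= v <= mu (C t0) & A = L v) \/
           (exists2 t, t0 <= t <= 1 & A = C t)].
have Lz : L (mu (hypersingleton z)) = hypersingleton z.
  have [|mLz Lzz _ _] := LP (mu (hypersingleton z)); first by rewrite lexx.
  apply/esym; apply: (whitney_eq mu_whitney); last by rewrite mLz.
  by move=> p ->.
have CL t v : t0 <= t <= 1 -> mu (hypersingleton z) <= v <= mu (C t0) ->
    hyperset (L v) `<=` hyperset (C t).
  move=> /andP[t0t t1] /LP[_ _ LC _]; apply: subset_trans LC _.
  have t01' : 0 <= t <= 1 by rewrite (le_trans t0_ge0).
  by rewrite !CE//; exact: swept_set_mono.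
have [|||||] := chain_order_arc mu_whitney (chain := chain)
    (A := hypersingleton z) (B := hyperfull).
- by left; exists (mu (hypersingleton z)); rewrite ?lexx.
- by right; exists 1; rewrite ?C1 ?lexx ?ltW.
- by apply: proper_full => zx; apply: (C_notin (t := t0));
    rewrite ?t0_ge0// -zx.
- move=> A B [[u uP ->]|[s sP ->]] [[v vP ->]|[t tP ->]].
  + have [uv|/ltW vu] := leP u v.
      left; have [_ _ _] := LP v vP; apply; rewrite uv andbT.
      by case/andP: uP.
    right; have [_ _ _] := LP u uP; apply; rewrite vu andbT.
    by case/andP: vP.
  + by left; exact: CL.
  + by right; exact: CL.
  + move: sP tP => /andP[t0s s1] /andP[t0t t1].
    by apply: C_total; rewrite ?s1 ?t1 (le_trans t0_ge0).
(* Values up to [mu (C t0)] are taken on the growth [L], larger ones on the sets [C t]. *)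
- move=> v /andP[zv v1]; have [vC|/ltW Cv] := leP v (mu (C t0)).
    have zvC : mu (hypersingleton z) <= v <= mu (C t0) by rewrite zv.
    by exists (L v); [left; exists v|have [] := LP v zvC].
  have [|t tP Ct] := swept_onto (v := v) mu_whitney f_cont CE t01.
    by rewrite Cv C1.
  by exists (C t) => //; right; exists t.
move=> alpha [[alpha_cont alpha_mono] alpha0 alpha1 alpha_chain].
exists alpha; split => // t /andP[t_ge0 t_lt1].
apply/seteqP; split=> // p [+ px]; rewrite {p}px => /= alpha_x.
have [|[v vP E]|[s sP E]] := alpha_chain t; first by rewrite t_ge0 ltW.
  apply: (C_notin (t := t0)); first by rewrite t0_ge0.
  by apply: (CL t0 v) => //; [rewrite lexx ltW|rewrite -E].
(* For [s < 1] the set [C s] misses [x]; for [s = 1] the arc would reach the whole space before time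
   1, against strictness. *)
have [s1|s1] := ltP s 1.
  case/andP: sP => t0s _.
  by apply: (C_notin (t := s)); rewrite ?(le_trans t0_ge0)// -E.
have {}s1 : s = 1 by apply/le_anti; rewrite s1 andbT; case/andP: sP.
have [_] := alpha_mono t 1 t_ge0 t_lt1 (lexx _).
by apply; rewrite alpha1 E s1 C1.
Qed.

(** By [swept_not_blocked], each [C t] with [t < 1] contains no blocked point, so the chain of all
    [C t] avoids all of $B(x)$ and not just [x] until it reaches the whole space. *)
Lemma unblocked_order_arc : y <> x -> exists alpha : R -> hyperspace X,
  [/\ order_arc alpha, alpha @` `[0, 1] `<=` subcontinua,
      alpha 0 = hypersingleton y, alpha 1 = hyperfull &
      forall t, 0 <= t < 1 -> hyperset (alpha t) `&` blocked_points x = set0].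
Proof.
move=> yx; have [mu mu_whitney] := @exists_whitney R X.
pose chain : set (hyperspace X) :=
  [set A | exists2 t, 0 <= t <= 1 & A = C t].
have [|||||] := chain_order_arc mu_whitney (chain := chain)
    (A := hypersingleton y) (B := hyperfull).
- by exists 0; rewrite ?C0 ?lexx ?ler01.
- by exists 1; rewrite ?C1 ?lexx ?ler01.
- exact: proper_full.
- by move=> A B [s sP ->] [t tP ->]; exact: C_total.
- move=> v; rewrite -C0 -C1 => v_mid.
  have [|t t01 Ct] := swept_onto (a := 0) mu_whitney f_cont CE _ v_mid.
    by rewrite lexx ler01.
  by exists (C t) => //; exists t.
move=> alpha [[alpha_cont alpha_mono] alpha0 alpha1 alpha_chain].
exists alpha; split => //.
  move=> _ [t + <-]; rewrite /= in_itv/= => /alpha_chain[s s01 E].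
  by rewrite /subcontinua/= E; exact: C_connected.
move=> t /andP[t_ge0 t_lt1]; apply/seteqP; split=> // p [alpha_p px].
have [|s /andP[s0 s1] E] := alpha_chain t; first by rewrite t_ge0 ltW.
move: s1; rewrite le_eqVlt => /predU1P[s1|s1].
  have [_] := alpha_mono t 1 t_ge0 t_lt1 (lexx _).
  by apply; rewrite alpha1 E s1 C1.
by apply: (swept_not_blocked (t0 := s)) px; [rewrite s0|rewrite -E].
Qed.

End unblocked_path.

(** A point outside $B(x)$ has a path avoiding [x] by definition, and sweeping that path gives the
    arc. *)
Lemma blocked_points_nonblocker x (clB : closed (blocked_points x)) :
  blocked_points x <> setT ->
  nonblocker (Hyperspace clB (ex_intro _ x (@blocked_points_refl x))).
Proof.
move=> BT; split; first by move=> /(congr1 (@hyperset R X))/BT.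
move=> y /= /contrapT [f [f_cont f0 f1 fx]].
have [C CE] := exists_swept f_cont f0.
apply: (unblocked_order_arc f_cont f0 f1 fx CE) => yx.
have := fx 0; rewrite lexx ltr01 f0 => /(_ isT) E.
by have : ([set y] `&` [set x]) y by []; rewrite E.
Qed.

(** For [y] outside [A], the order arc avoiding [A] is in particular a path avoiding [x]. *)
Lemma blocked_points_sub_nonblocker x A :
  nonblocker A -> hyperset A x -> blocked_points x `<=` hyperset A.
Proof.
move=> [_ nbA] Ax y; apply: contraPP => /nbA[f [[f_cont _] _ f0 f1 fA]].
apply; exists f; split => // t t01; apply/seteqP; split=> // p [fp px].
by rewrite -(fA t t01); split => //; rewrite px.
Qed.

End blocked_points.

Theorem proposition3p1 (R : realType) (X : continuumType R) (x : X) :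
  closed (blocked_points x) -> blocked_points x = nonblocker_hull x.
Proof.
move=> clB; rewrite /nonblocker_hull; case: pselect => [[A [nbA Ax]]|nonb].
  apply/seteqP; split=> [y xy A' [nbA' A'x]|y].
    exact: blocked_points_sub_nonblocker xy.
  (* $B(x)$ is itself one of the intersected sets: it is proper because it lies in the nonblocker
     [A]. *)
  move=> /(_ (Hyperspace clB (ex_intro _ x (@blocked_points_refl R X x)))).
  apply; split; last exact: blocked_points_refl.
  apply: blocked_points_nonblocker => BT; apply: nbA.1.
  apply: hyperset_inj; apply/seteqP; split=> // p _.
  by apply: (blocked_points_sub_nonblocker nbA Ax); rewrite BT.
(* If $B(x)$ were proper, it would be a nonblocker containing [x], and here there is none. *)
rewrite /=; apply: contrapT => BT; apply: nonb.
exists (Hyperspace clB (ex_intro _ x (@blocked_points_refl R X x))).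
by split; [exact: blocked_points_nonblocker|exact: blocked_points_refl].
Qed.
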